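(* Let $\varepsilon\in(0,1)$ and let $d\ge 2$ be an integer. Then there exists $C=C(\varepsilon,d)>0$ such that the following holds. For every $n$, let $T$ be a tree on at most $(1-\varepsilon)n$ vertices with maximum degree $d$, and suppose $\mathbf{G}\sim\mathbf{G}(n,C/n)$ is uniformly edge-coloured in $[n]$. Then, with probability tending to $1$ as $n\to\infty$, $\mathbf{G}$ contains a rainbow copy of $T$.
   Context: $\mathbf{G}(n,p)$ is the binomial random graph on $[n]$ with edge probability $p$. Uniformly edge-coloured in $\mathcal{C}$: each edge independently gets a uniformly random colour from $\mathcal{C}$. Rainbow: all edges have distinct colours. *)

(* Defs.v *)
From HB Require Import structures.
From mathcomp Require Import all_boot all_order all_algebra.
From mathcomp Require Import all_classical all_reals all_analysis.

Set Implicit Arguments.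
Unset Strict Implicit.
Unset Printing Implicit Defensive.

Import Order.TTheory GRing.Theory Num.Theory.
Import numFieldNormedType.Exports.

Local Open Scope ring_scope.

Definition pairs (V : finType) : {set {set V}} := [set e : {set V} | #|e| == 2]%SET.

Definition sgraph (V : finType) : finType :=
  {E : {set {set V}} | E \subset pairs V}.

Definition edges (V : finType) (G : sgraph V) : {set {set V}} := val G.

Definition edge (V : finType) (G : sgraph V) : finType :=
  {e : {set V} | e \in edges G}.

Definition adj (V : finType) (G : sgraph V) : rel V :=
  fun x y => [set x; y]%SET \in edges G.

Definition degree (V : finType) (G : sgraph V) (x : V) : nat :=
  #|[set y | adj G x y]%SET|.

Definition max_degree (V : finType) (G : sgraph V) : nat :=
  \max_(x : V) degree G x.

Definition connected_graph (V : finType) (G : sgraph V) : Prop :=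
  (0 < #|V|)%N /\ forall x y : V, connect (adj G) x y.

(* [ucycle] accepts the sequence [:: x; y] for every edge xy, so graph cycles
   are the [ucycle]s with at least three vertices. *)
Definition acyclic (V : finType) (G : sgraph V) : Prop :=
  forall s : seq V, ucycle (adj G) s -> (size s < 3)%N.

Definition is_tree (V : finType) (G : sgraph V) : Prop :=
  connected_graph G /\ acyclic G.

Definition colouring (V : finType) (G : sgraph V) (K : finType) : finType :=
  {ffun edge G -> K}.

Definition rainbow (V : finType) (G : sgraph V) (K : finType)
    (c : colouring G K) (F : {set {set V}}) : Prop :=
  forall e1 e2 : edge G, val e1 \in F -> val e2 \in F -> c e1 = c e2 -> e1 = e2.

Definition has_rainbow_copy (W : finType) (T : sgraph W) (V : finType)
    (G : sgraph V) (K : finType) (c : colouring G K) : Prop :=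
  exists f : W -> V, injective f /\
    let F := [set f @: (e : {set W}) | e in edges T]%SET in
    F \subset edges G /\ rainbow c F.

Definition Gnp_weight (R : realType) (V : finType) (p : R) (G : sgraph V) : R :=
  \prod_(e in pairs V) (if e \in edges G then p else 1 - p).

Definition uniform_colouring_weight (R : realType) (V : finType)
    (G : sgraph V) (K : finType) (c : colouring G K) : R :=
  \prod_(e : edge G) (#|K|%:R)^-1.

(* Probability of the event [A] for the binomial random graph on [V] with edge
   probability [p], uniformly edge-coloured in [K].  It is meaningful only for
   0 <= p <= 1, and the weights do not sum to 1 if [K] is empty and [V] has at
   least two elements. *)
Definition Gnp_coloured_prob (R : realType) (V : finType) (p : R) (K : finType)
    (A : forall G : sgraph V, colouring G K -> Prop) : R :=
  \sum_(G : sgraph V) Gnp_weight p G *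
    \sum_(c : colouring G K | `[< A G c >]) uniform_colouring_weight R c.

(* Main.v *)
(** Following McDiarmid, the colours are removed by a coupling.  Reveal the pairs
    one at a time, turning an uncoloured pair of rate [eps * p] into a coloured
    pair of rate [p]: if the pair [e] completes a copy of the tree whose coloured
    edges are otherwise distinctly coloured, then [e] may take any of the at least
    [eps * n] colours missing from that copy, so success is at least as likely
    after the change.  Hence it suffices to find an uncoloured copy in
    [G(n, eps * C / n)].  There, a union bound shows that with high probability
    any two disjoint sets of [m] vertices are joined by an edge, where [m] is a
    small multiple of [n].  In such a graph one deletes fewer than [m] vertices to
    make all sets of size at most [2 m] expand, and embeds the tree vertex by
    vertex with the Friedman-Pippenger argument. *)
Require Import Defs.
From HB Require Import structures.
From mathcomp Require Import all_boot all_order all_algebra.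
From mathcomp Require Import all_classical all_reals all_analysis.
From mathcomp Require Import zify ring lra.

Set Implicit Arguments.
Unset Strict Implicit.
Unset Printing Implicit Defensive.

Import Order.TTheory GRing.Theory Num.Theory.
Import numFieldNormedType.Exports.

Local Open Scope classical_set_scope.
Local Open Scope ring_scope.

(** * Expansion and extension *)

Section Expansion.
Local Open Scope nat_scope.
Variables (V : finType) (g : rel V).
Implicit Types (S U A B Z : {set V}).

Definition nbhd U : {set V} := [set y | [exists u in U, g u y]]%SET.

Lemma in_nbhd U y : (y \in nbhd U) = [exists u in U, g u y].
Proof. by rewrite inE. Qed.

Lemma nbhd0 : nbhd finset.set0 = finset.set0.
Proof. by apply/setP=> y; rewrite !inE; apply/existsP=> -[u]; rewrite inE. Qed.

Lemma nbhdU U A : nbhd (U :|: A) = nbhd U :|: nbhd A.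
Proof.
apply/setP=> y; rewrite finset.in_setU !in_nbhd; apply/existsP/orP.
  move=> [u /andP[]]; rewrite finset.in_setU => /orP[uU|uA] guy.
    by left; apply/existsP; exists u; rewrite uU.
  by right; apply/existsP; exists u; rewrite uA.
by case=> /existsP[u /andP[uU guy]]; exists u; rewrite finset.in_setU uU ?orbT.
Qed.

Lemma nbhdS U A : U \subset A -> nbhd U \subset nbhd A.
Proof. by move/finset.setUidPr <-; rewrite nbhdU finset.subsetUl. Qed.

(** [S] holds the used or deleted vertices and [w u] the number of new neighbours that [u] may still
    demand: a Hall condition restricted to sets of at most [k] vertices. *)
Definition expands S (w : V -> nat) k :=
  forall U, #|U| <= k -> \sum_(u in U) w u <= #|nbhd U :\: S|.

Lemma sum_setUI (w : V -> nat) U A :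
  \sum_(u in U :|: A) w u + \sum_(u in U :&: A) w u =
  \sum_(u in U) w u + \sum_(u in A) w u.
Proof.
have E X : \sum_(u in X) w u = \sum_u (u \in X) * w u.
  by rewrite big_mkcond; apply: eq_bigr => u _; case: (u \in X); rewrite ?mul1n ?mul0n.
rewrite !E -!big_split; apply: eq_bigr => u _ /=.
by rewrite !inE; case: (u \in U); case: (u \in A); rewrite /= ?mul1n ?mul0n ?addn0 ?add0n.
Qed.

(* Tight sets are closed under union, by submodularity of [#|nbhd U :\: S|];
   if no choice of [y] worked, the union of the tight sets avoiding [s] would
   swallow all free neighbours of [s], and adding [s] to it would break
   expansion. *)
Lemma expands_extend S w m s :
  0 < m -> 0 < w s -> expands S w m.*2 ->
  (forall U, m <= #|U| <= m.*2 -> \sum_(u in U) w u < #|nbhd U :\: S|) ->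
  exists y, [/\ g s y, y \notin S &
    expands (y |: S) (fun u => w u - (u == s)) m.*2].
Proof.
move=> m0 ws hS hbig; apply: contrapT => hno.
pose tight U := [&& #|U| < m, \sum_(u in U) w u == #|nbhd U :\: S| & s \notin U].
have tightU U A : tight U -> tight A -> tight (U :|: A).
  move=> /and3P[Um /eqP tU sU] /and3P[Am /eqP tA sA].
  have UA2 : #|U :|: A| <= m.*2.
    by have := cardsUI U A; lia.
  have lU := hS _ UA2.
  have lI : \sum_(u in U :&: A) w u <= #|nbhd (U :&: A) :\: S|.
    by apply: hS; have := cardsUI U A; lia.
  have sub : #|nbhd (U :|: A) :\: S| + #|nbhd (U :&: A) :\: S| <=
             #|nbhd U :\: S| + #|nbhd A :\: S|.
    rewrite -[leqRHS]cardsUI nbhdU finset.setDUl leq_add2l subset_leq_card //.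
    by rewrite finset.subsetI !finset.setSD ?nbhdS ?finset.subsetIl ?finset.subsetIr.
  have := sum_setUI w U A => e.
  have eq : \sum_(u in U :|: A) w u = #|nbhd (U :|: A) :\: S| by lia.
  apply/and3P; split; last by rewrite inE negb_or sU.
    (* From size [m] on, [hbig] makes the inequality strict, so a set attaining equality is smaller
       than [m]. *)
    rewrite ltnNge; apply/negP => mUA.
    by have := hbig (U :|: A); rewrite mUA UA2 eq ltnn => /(_ isT).
  by rewrite eq.
have tight0 : tight finset.set0.
  by rewrite /tight cards0 m0 big_set0 nbhd0 finset.set0D cards0 inE eqxx.
pose U := (\bigcup_(A | tight A) A)%SET.
have /and3P[Um /eqP tU sU] : tight U by apply: (big_ind (fun X => tight X)).
(* A free neighbour of [s] outside [nbhd U] would be a valid choice: a set containing [s] loses a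
   unit of demand to offset the lost vertex, and any other set could fail only if tight, hence
   inside [U]. *)
have cover y : g s y -> y \notin S -> y \in nbhd U.
  move=> gsy yS; apply: contrapT => yU; apply: hno; exists y; split => // A A2.
  have cD : #|nbhd A :\: S| = (y \in nbhd A) + #|nbhd A :\: (y |: S)|.
    by rewrite (cardsD1 y) finset.setDDl finset.setUC finset.in_setD yS.
  have [sA|sA] := boolP (s \in A).
    have e : \sum_(u in A) w u = (\sum_(u in A) (w u - (u == s))).+1.
      rewrite (bigD1 s) //= [in RHS](bigD1 s) //= eqxx subn1 -addSn prednK //.
      by congr addn; apply: eq_bigr => u /andP[_ /negPf ->]; rewrite subn0.
    by have := hS A A2; move: cD; case: (y \in _); lia.
  under eq_bigr => u uA.
    rewrite (_ : (u == s) = false) ?subn0; last by apply: contraNF sA => /eqP <-.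
  over.
  have [yA|yA] := boolP (y \in nbhd A); last first.
    by rewrite (negPf yA) in cD; have := hS A A2; lia.
  suff : \sum_(u in A) w u < #|nbhd A :\: S| by rewrite cD yA.
  have [mA|Am] := leqP m #|A|; first by apply: hbig; rewrite mA.
  rewrite ltn_neqAle hS // andbT; apply/negP => tA.
  have AU : A \subset U by apply: finset.bigcup_sup; apply/and3P.
  by apply: yU; apply: fintype.subsetP (nbhdS AU) _ yA.
have U1 : #|s |: U| <= m.*2 by rewrite cardsU1; lia.
have := hS _ U1; rewrite big_setU1 //= tU nbhdU.
have sub : (nbhd [set s] :|: nbhd U) :\: S \subset nbhd U :\: S.
  apply/fintype.subsetP => y; rewrite finset.in_setD finset.in_setU => /andP[yS].
  rewrite finset.in_setD yS => /orP[|//]; rewrite in_nbhd => /existsP[u].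
  by rewrite finset.in_set1 => /andP[/eqP -> gsy]; exact: cover.
by have := subset_leq_card sub; lia.
Qed.

Lemma subset_of_card A m :
  m <= #|A| -> exists2 A' : {set V}, A' \subset A & #|A'| = m.
Proof.
move=> mA.
have /card_gt0P[A'] : 0 < #|[set A' : {set V} | A' \subset A & #|A'| == m]%SET|.
  by rewrite cards_draws bin_gt0.
by rewrite inE => /andP[? /eqP ?]; exists A'.
Qed.

Lemma cardsU_D A B : #|A :|: B| = #|A| + #|B :\: A|.
Proof.
by rewrite cardsU cardsD finset.setIC addnBA // subset_leq_card ?finset.subsetIl.
Qed.

Definition joined m :=
  forall A B, #|A| = m -> #|B| = m -> A :&: B = finset.set0 ->
  [exists a in A, exists b in B, g a b].

(** Otherwise the complement of [A :|: nbhd A] would contain an [m]-set with no edge from an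
    [m]-subset of [A]. *)
Lemma joined_nbhd m A : joined m -> m <= #|A| -> #|V| < #|A :|: nbhd A| + m.
Proof.
move=> jm mA; rewrite -(cardsC (A :|: nbhd A)) ltn_add2l ltnNge.
apply/negP => mB.
have [A' A'A cA'] := subset_of_card mA.
have [B' B'B cB'] := subset_of_card mB.
have dAB : A' :&: B' = finset.set0.
  apply/setP => x; rewrite finset.in_setI finset.in_set0; apply/negP => /andP[].
  by move=> /(fintype.subsetP A'A) xA /(fintype.subsetP B'B); rewrite !inE xA.
have /existsP[a /andP[aA /existsP[b /andP[bB gab]]]] := jm _ _ cA' cB' dAB.
have := fintype.subsetP B'B _ bB; rewrite finset.in_setC finset.in_setU => /negP; apply.
rewrite in_nbhd orbC; apply/orP; left; apply/existsP; exists a.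
by rewrite gab (fintype.subsetP A'A).
Qed.

(* Deleting a largest set [Z] of size below [m] that fails to expand leaves a
   graph in which all sets of size at most [2m] expand. *)
Lemma joined_expands m D :
  joined m -> 0 < m -> (3 * D + 4) * m <= #|V| ->
  exists2 Z : {set V}, #|Z| < m & expands Z (fun u => (u \notin Z) * D) m.*2.
Proof.
move=> jm m0 hV.
pose P (Z : {set V}) := (#|Z| < m) && (#|nbhd Z :\: Z| <= D * #|Z|).
have P0 : P finset.set0 by rewrite /P cards0 m0 nbhd0 finset.set0D cards0.
case: (arg_maxnP (fun Z : {set V} => #|Z|) P0) => Z /andP[Zm hZ] Zmax; exists Z => // U U2.
have -> : \sum_(u in U) (u \notin Z) * D = D * #|U :\: Z|.
  rewrite -sum1_card big_distrr /= [RHS]big_mkcond [LHS]big_mkcond.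
  apply: eq_bigr => u _; rewrite finset.in_setD.
  by case: (u \in Z); case: (u \in U); rewrite /= ?muln0 ?muln1 ?mul1n.
suff h : D * #|U :\: Z| <= #|nbhd (U :\: Z) :\: Z|.
  by apply: leq_trans h _; rewrite subset_leq_card ?finset.setSD ?nbhdS ?finset.subsetDl.
rewrite leqNgt; apply/negP => h.
set U' := U :\: Z in h *.
have U'0 : 0 < #|U'| by rewrite lt0n; apply/eqP => e; rewrite e muln0 in h.
have U'2 : #|U'| <= m.*2 by apply: leq_trans U2; rewrite subset_leq_card ?finset.subsetDl.
have dZU : #|Z :|: U'| = #|Z| + #|U'|.
  by rewrite cardsU_D finset.setDDl finset.setUid.
set A := Z :|: U' in dZU *.
have hA : #|nbhd A :\: A| <= D * #|A|.
  rewrite dZU mulnDr; apply: leq_trans (leq_add hZ (ltnW h)).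
  apply: leq_trans (leq_card_setU _ _).1; apply: subset_leq_card.
  rewrite nbhdU finset.setDUl finset.setUSS //.
    by rewrite finset.setDS // finset.subsetUl.
  by rewrite finset.setDS // finset.subsetUl.
(* [A] is strictly larger than [Z] and also fails to expand, so maximality forces its size up to
   [m]. Since [A] has fewer than [3m] vertices, [A :|: nbhd A] has fewer than [3(D+1)m]; adding the
   [m] from [joined_nbhd] gives the constant [3D+4]. *)
have mA : m <= #|A|.
  rewrite leqNgt; apply/negP => Am.
  have := Zmax A; rewrite /P Am hA => /(_ isT) /=; lia.
have := joined_nbhd jm mA.
rewrite cardsU_D; nia.
Qed.

End Expansion.

(** * Trees *)

Section Trees.
Local Open Scope nat_scope.
Variables (W : finType) (T : sgraph W).
Implicit Types (A : {set W}).

Lemma edge_card2 (e : {set W}) : e \in edges T -> #|e| = 2.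
Proof. by move/(fintype.subsetP (valP T)); rewrite inE => /eqP. Qed.

Lemma adj_sym : symmetric (adj T).
Proof. by move=> x y; rewrite /adj finset.setUC. Qed.

Lemma adj_irr x : adj T x x = false.
Proof.
apply/negP => /edge_card2; rewrite finset.setUid cards1; lia.
Qed.

Lemma connect_boundary (e : rel W) A x y :
  connect e x y -> x \in A -> y \notin A ->
  exists u v, [/\ u \in A, v \notin A & e u v].
Proof.
move=> /connectP[p]; elim: p x => [|z p IH] x /= => [_ -> -> //|].
move=> /andP[exz pz] yE xA yA; have [zA|zA] := boolP (z \in A).
  exact: IH pz yE zA yA.
by exists x, z.
Qed.

Definition adj_in A : rel W := fun x y => [&& x \in A, y \in A & adj T x y].

Lemma path_adj_in A x p : path (adj_in A) x p -> all (mem A) p.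
Proof. by elim: p x => //= y p IH x /andP[/and3P[_ -> _] /IH]. Qed.

(** Two distinct neighbours of [y] in the connected set [A] would be linked by a simple path inside
    [A], which [y] closes into a cycle of length at least three. *)
Lemma acyclic_attach A x y z :
  acyclic T -> (forall u v, u \in A -> v \in A -> connect (adj_in A) u v) ->
  x \in A -> y \notin A -> z \in A -> adj T x y -> adj T z y -> z = x.
Proof.
move=> acT cA xA yA zA xy zy; apply/eqP; apply: contraTT isT => zx.
have /connectP[p pp zE] := cA x z xA zA; move: zE.
case: (shortenP pp) => q qq uq _ zE.
have : ucycle (adj T) (y :: x :: q).
  apply/andP; split; last first.
    rewrite cons_uniq uq andbT; apply: contra yA; rewrite inE => /predU1P[-> //|].
    by move/(allP (path_adj_in qq)).
  rewrite /= adj_sym xy rcons_path -zE zy andbT.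
  by apply: sub_path qq => u v /and3P[].
move=> /acT /=; case: q {uq qq} zE => //= zE _.
by rewrite zE eqxx in zx.
Qed.

(** Induction by attaching leaves to a growing subtree. The proof also carries the connectedness of
    [A] within itself, from which acyclicity gives the uniqueness of the neighbour [x]. *)
Lemma tree_grow_ind (P : {set W} -> Prop) :
  is_tree T -> (forall x, P [set x]%SET) ->
  (forall A x y, x \in A -> y \notin A -> adj T x y ->
     (forall z, z \in A -> adj T z y -> z = x) -> P A -> P (y |: A)) ->
  P finset.setT.
Proof.
move=> [[W0 cT] acT] P1 PS.
suff H k : k < #|W| -> exists A,
    [/\ #|A| = k.+1, P A & forall u v, u \in A -> v \in A -> connect (adj_in A) u v].
  have [|A [cA PA _]] := H #|W|.-1; first by rewrite prednK.
  suff -> : finset.setT = A by [].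
  by apply/esym/eqP; rewrite eqEcard finset.subsetT cardsT cA prednK /=.
elim: k => [|k IH] kW.
  have /card_gt0P[x _] := W0; exists [set x]%SET; split => //; first by rewrite cards1.
  by move=> u v /set1P -> /set1P ->; exact: connect0.
have [A [cA PA conA]] := IH (ltnW kW).
have /card_gt0P[x0 x0A] : 0 < #|A| by rewrite cA.
have /card_gt0P[y0] : 0 < #|~: A| by have := cardsC A; lia.
rewrite finset.in_setC => y0A.
have [x [y [xA yA xy]]] := connect_boundary (cT x0 y0) x0A y0A.
exists (y |: A); split; first by rewrite cardsU1 yA cA.
  apply: (PS _ _ _ xA yA xy _ PA) => z zA zy.
  exact: (acyclic_attach acT conA xA yA zA xy zy).
have sub u v : u \in A -> v \in A -> connect (adj_in (y |: A)) u v.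
  move=> uA vA; apply: connect_sub (conA u v uA vA) => a b /and3P[aA bA ab].
  by apply: connect1; rewrite /adj_in !finset.in_setU aA bA ab !orbT.
have yx : connect (adj_in (y |: A)) y x.
  by apply: connect1; rewrite /adj_in !finset.in_setU xA finset.set11 orbT adj_sym.
have xy' : connect (adj_in (y |: A)) x y.
  by apply: connect1; rewrite /adj_in !finset.in_setU xA finset.set11 orbT.
move=> u v /setU1P[->|uA] /setU1P[->|vA] //.
- exact: connect_trans yx (sub _ _ xA vA).
- exact: connect_trans (sub _ _ uA xA) xy'.
- exact: sub.
Qed.

(** Each attached leaf brings at most one new edge. This bounds the number of colours that a copy of
    the tree can block. *)
Lemma tree_edges_le : is_tree T -> #|edges T| <= #|W|.
Proof.
move=> treeT.
suff : #|[set e in edges T | e \subset finset.setT]%SET| <= #|[set: W]%SET|.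
  rewrite cardsT; apply: leq_trans; apply: subset_leq_card.
  by apply/fintype.subsetP => e eT; rewrite inE eT finset.subsetT.
apply: (tree_grow_ind
  (P := fun A => #|[set e in edges T | e \subset A]%SET| <= #|A|)) => //.
  move=> x; rewrite cards1; apply: leq_trans (_ : 0 <= _) => //.
  rewrite leqn0 cards_eq0; apply/eqP/setP => e; rewrite !inE.
  apply/negP => /andP[/edge_card2 e2 /subset_leq_card]; rewrite cards1; lia.
move=> A x y xA yA xy uxy IH; rewrite cardsU1 yA.
apply: leq_trans
  (_ : #|[set x; y]%SET |: [set e in edges T | e \subset A]%SET| <= _); last first.
  by rewrite cardsU1 leq_add ?leq_b1.
apply: subset_leq_card; apply/fintype.subsetP => e; rewrite inE => /andP[eT eyA].
rewrite finset.in_setU1 inE eT; have [ye|ye] := boolP (y \in e); last first.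
  apply/orP; right; apply/fintype.subsetP => z ze.
  have := fintype.subsetP eyA z ze; rewrite in_setU1 => /predU1P[zy|//].
  by rewrite zy (negPf ye) in ze.
have : #|e :\ y| == 1 by have := edge_card2 eT; rewrite (cardsD1 y) ye; lia.
move=> /cards1P[z ez]; have eE : e = [set z; y]%SET.
  by rewrite -(finset.setD1K ye) ez finset.setUC.
have zA : z \in A.
  have : z \in e :\ y by rewrite ez finset.set11.
  rewrite in_setD1 => /andP[zy /(fintype.subsetP eyA)].
  by rewrite in_setU1 (negPf zy).
by rewrite eE (uxy z zA) ?eqxx // /adj -eE.
Qed.

End Trees.

(** * Embedding a tree in a graph with joined sets *)

Lemma joined_tree_embedding (V W : finType) (g : rel V) (T : sgraph W) (m d : nat) :
  symmetric g -> joined g m -> (0 < m)%N -> is_tree T -> (max_degree T <= d)%N ->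
  (#|W| + (3 * d.+1 + 4) * m <= #|V|)%N ->
  exists2 f : W -> V, injective f & forall x y, adj T x y -> g (f x) (f y).
Proof.
move=> gs jm m0 treeT dT hV.
have degT x : (degree T x <= d)%N by apply: leq_trans dT; exact: leq_bigmax.
have [|Z Zm Zexp] := joined_expands (D := d.+1) jm m0; first by lia.
(* Outside [U] fewer than [m] vertices are missed by [nbhd g U]; removing [U] and [S] as well still
   leaves more than [3(d+1)m] of the vertices of [V], against a demand of at most [2m(d+1)]. *)
have big (S : {set V}) (w : V -> nat) (U : {set V}) :
    (#|S| < m + #|W|)%N -> (forall v, w v <= d.+1)%N ->
    (m <= #|U| <= m.*2)%N -> (\sum_(u in U) w u < #|nbhd g U :\: S|)%N.
  move=> Sm wd /andP[mU U2].
  have := joined_nbhd jm mU; rewrite cardsU => h1.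
  have h2 : (\sum_(u in U) w u <= #|U| * d.+1)%N.
    by rewrite -sum_nat_const; apply: leq_sum.
  have := cardsD (nbhd g U) S.
  have : (#|nbhd g U :&: S| <= #|S|)%N by rewrite subset_leq_card ?finset.subsetIr.
  nia.
(* Invariant: [f] embeds the part [A], the image of each placed vertex has demand for all its
   unplaced neighbours, and every free vertex keeps demand at least [d]. *)
pose good (A : {set W}) := exists (f : W -> V) (w : V -> nat),
  [/\ {in A &, injective f}, {in A &, forall x y, adj T x y -> g (f x) (f y)},
      expands g (Z :|: f @: A) w m.*2,
      {in A, forall x, #|[set y | adj T x y]%SET :\: A| <= w (f x)}%N
    & (forall v, w v <= d.+1)%N /\ (forall v, v \notin Z :|: f @: A -> d <= w v)%N].
suff [f [w [injf gf _ _ _]]] : good finset.setT.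
  by exists f => [x y|x y]; [apply: injf|apply: gf]; rewrite ?inE.
apply: tree_grow_ind treeT _ _ =>
  [x|A x y xA yA xy uxy [f [w [injf gf fexp fw [wd wfree]]]]].
  (* The first vertex is placed at a neighbour of an auxiliary vertex [s], which is charged one
     unit; starting from [d.+1] leaves demand [d] even at [s]. *)
  have /card_gt0P[s] : (0 < #|~: Z|)%N by have := cardsC Z; lia.
  rewrite finset.in_setC => sZ.
  have [|U hU|v [_ vZ vexp]] := expands_extend (s := s) m0 _ Zexp.
  - by rewrite sZ.
  - by apply: big => //; [lia|move=> v; case: (v \notin Z); lia].
  exists (fun=> v), (fun u => (u \notin Z) * d.+1 - (u == s))%N; split.
  - by move=> a b /set1P -> /set1P ->.
  - by move=> a b /set1P -> /set1P ->; rewrite adj_irr.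
  - rewrite (_ : Z :|: _ = v |: Z) // finset.setUC; congr (_ :|: _).
    by rewrite finset.imset_set1.
  - move=> a _; rewrite vZ mul1n; apply: leq_trans (_ : d <= _)%N; last by case: (_ == _); lia.
    apply: leq_trans (degT a); apply: subset_leq_card; exact: finset.subsetDl.
  - split=> u; first by case: (u \notin Z); lia.
    by rewrite finset.in_setU negb_or => /andP[-> _]; case: (_ == _); lia.
set S := Z :|: f @: A in fexp wfree *.
have cS : (#|S| < m + #|W|)%N.
  have : (#|f @: A| <= #|W|)%N.
    exact: leq_trans (leq_imset_card _ _) (max_card _).
  by rewrite /S cardsU; lia.
have wx : (0 < w (f x))%N.
  apply: leq_trans (fw x xA); apply/card_gt0P; exists y.
  by rewrite finset.in_setD yA inE.
have [|v [gv vS vexp]] := expands_extend m0 wx fexp; first by move=> U; apply: big.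
have fxS a : a \in A -> f a \in S.
  by move=> aA; rewrite /S finset.in_setU imset_f ?orbT.
have vf a : a \in A -> f a != v by move=> /fxS aS; apply: contraNneq vS => <-.
pose f' a := if a == y then v else f a.
have f'y : f' y = v by rewrite /f' eqxx.
have f'A a : a \in A -> f' a = f a.
  by move=> aA; rewrite /f' ifN //; apply: contraNneq yA => <-.
have f'S : Z :|: f' @: (y |: A) = v |: S.
  rewrite finset.imsetU1 f'y (finset.eq_in_imset f'A) /S.
  by rewrite finset.setUCA.
exists f', (fun u => w u - (u == f x))%N; rewrite f'S; split => //.
- move=> a b /setU1P[->|aA] /setU1P[->|bA] //; rewrite ?f'y ?f'A //.
  + by move=> /esym/eqP; rewrite (negPf (vf _ bA)).
  + by move=> /eqP; rewrite (negPf (vf _ aA)).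
  + exact: injf.
- move=> a b /setU1P[->|aA] /setU1P[->|bA]; rewrite ?f'y ?f'A ?adj_irr //.
  + by rewrite adj_sym gs => /(uxy _ bA) ->.
  + by move=> /(uxy _ aA) ->.
  + exact: gf.
- move=> a /setU1P[->|aA]; rewrite ?f'y ?f'A //.
    (* The image [v] was free, so its demand covers all neighbours of [y]. *)
    rewrite [_ == _](negPf _) 1?eq_sym ?vf // subn0.
    apply: leq_trans (wfree _ vS); apply: leq_trans (degT y).
    by apply: subset_leq_card; exact: finset.subsetDl.
  (* Among placed vertices only [x] loses a unit of demand, and [y] has just left its unplaced
     neighbours. *)
  have [fax|fax] := eqVneq (f a) (f x).
    have -> : a = x by apply: injf.
    rewrite subn1 -ltnS prednK //; apply: leq_trans (fw x xA).
    rewrite [leqRHS](cardsD1 y) finset.setDDl finset.setUC.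
    by rewrite finset.in_setD yA inE xy.
  rewrite subn0; apply: leq_trans (fw a aA); apply: subset_leq_card.
  by rewrite finset.setDS // finset.subsetUr.
- split=> u; first by apply: leq_trans (wd u); rewrite leq_subr.
  rewrite in_setU1 negb_or => /andP[_ uS].
  rewrite [_ == _](negPf _) ?subn0 ?wfree //.
  by apply: contraNneq uS => ->; rewrite fxS.
Qed.

(** * McDiarmid coupling *)

Section MarkedSets.
Variables (R : realType) (I K : finType).
Hypothesis K0 : (0 < #|K|)%N.
Implicit Types (r p q : I -> R) (e : I) (o : {ffun I -> option K}) (B D : {set I}).

(** Presence and colour form a single random variable: [None] is absence, [Some k] is presence with
    colour [k]. A coloured random graph thus becomes a product measure. *)
Definition mark (x : R) (s : option K) : R :=
  if s is Some _ then x / #|K|%:R else 1 - x.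

Definition marking_weight r o : R := \prod_i mark (r i) (o i).

Definition marking_prob r (A : pred {ffun I -> option K}) : R :=
  \sum_(o | A o) marking_weight r o.

Let KR : 0 < #|K|%:R :> R. Proof. by rewrite ltr0n. Qed.

Lemma sum_option (F : option K -> R) :
  \sum_s F s = F None + \sum_k F (Some k).
Proof.
rewrite (bigD1 None) //=; congr (_ + _).
rewrite (reindex_omap (some : K -> option K) id) => [|[k|]//].
by apply: eq_bigl => k; rewrite eqxx.
Qed.

Lemma sum_mark x : \sum_s mark x s = 1.
Proof.
rewrite sum_option /= sumr_const -mulr_natr; field.
by rewrite gt_eqF.
Qed.

Lemma mark_ge0 x s : 0 <= x <= 1 -> 0 <= mark x s.
Proof.
by case: s => [k|] /= /andP[x0 x1]; rewrite ?subr_ge0 // divr_ge0 // ltW.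
Qed.

Lemma marking_weight_ge0 r o : (forall i, 0 <= r i <= 1) -> 0 <= marking_weight r o.
Proof. by move=> r01; apply: prodr_ge0 => i _; exact: mark_ge0. Qed.

Lemma marking_probE r (A : pred {ffun I -> option K}) :
  marking_prob r A = \sum_o marking_weight r o * (A o)%:R.
Proof.
rewrite /marking_prob big_mkcond; apply: eq_bigr => o _.
by case: (A o); rewrite ?mulr1 ?mulr0.
Qed.

(** By independence the sum factors over coordinates, and those outside [D] contribute 1. An empty
    [D] gives the total mass, a cut gives the probability that no edge crosses it. *)
Lemma marking_prob_cylinder r D :
  marking_prob r [pred o : {ffun I -> option K} | [forall i in D, o i == None]] =
  \prod_(i in D) (1 - r i).
Proof.
rewrite marking_probE.
transitivity (\sum_(o : {ffun I -> option K})
  \prod_i (mark (r i) (o i) * ((i \in D) ==> (o i == None))%:R)).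
  apply: eq_bigr => o _; rewrite big_split /=; congr (_ * _).
  case: (boolP [forall i in D, o i == None]) => [/forallP h|/forallPn[i hi]].
    by rewrite big1 // => i _; rewrite h.
  by rewrite (bigD1 i) //= (negPf hi) mul0r.
rewrite -(bigA_distr_bigA (fun i s => mark (r i) s * ((i \in D) ==> (s == None))%:R)).
rewrite [RHS]big_mkcond; apply: eq_bigr => i _; case: (boolP (i \in D)) => /= _.
  rewrite sum_option eqxx mulr1 big1 ?addr0 // => k _.
  by rewrite mulr0.
by under eq_bigr do rewrite mulr1; exact: sum_mark.
Qed.

Lemma marking_prob1 r : marking_prob r predT = 1.
Proof.
have <- : \prod_(i in finset.set0) (1 - r i) = 1 by rewrite big_set0.
rewrite -marking_prob_cylinder.
by apply: eq_bigl => o /=; apply/esym/forallP => i; rewrite finset.in_set0.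
Qed.

Lemma marking_prob_le r (A B : pred {ffun I -> option K}) :
  (forall i, 0 <= r i <= 1) -> {subset A <= B} -> marking_prob r A <= marking_prob r B.
Proof.
move=> r01 AB; rewrite !marking_probE; apply: ler_sum => o _.
apply: ler_wpM2l; first exact: marking_weight_ge0.
by case: (boolP (A o)) => [/AB|_]; rewrite ?ler0n // => /= h; rewrite [B o]h.
Qed.

Lemma marking_prob_union r (J : finType) (P : pred J) (A : pred {ffun I -> option K})
    (F : J -> pred {ffun I -> option K}) :
  (forall i, 0 <= r i <= 1) ->
  (forall o, A o -> exists2 j, P j & F j o) ->
  marking_prob r A <= \sum_(j | P j) marking_prob r (F j).
Proof.
move=> r01 AF; under [leRHS]eq_bigr do rewrite marking_probE.
rewrite exchange_big marking_probE /=; apply: ler_sum => o _.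
rewrite -mulr_sumr; apply: ler_wpM2l; first exact: marking_weight_ge0.
case: (boolP (A o)) => [/AF[j Pj Fj]|_]; last by apply: sumr_ge0.
by rewrite (bigD1 j) //= Fj lerDl; apply: sumr_ge0.
Qed.

Definition upd o e s : {ffun I -> option K} := [ffun i => if i == e then s else o i].

(** Fubini in the coordinate [e]: once it is averaged separately, the value [o e] is a dummy, so
    [r'] may differ from [r] there. This lets two rate functions share one outer measure. *)
Lemma marking_resample r r' e (F : {ffun I -> option K} -> R) :
  (forall i, i != e -> r i = r' i) ->
  \sum_o marking_weight r o * F o =
  \sum_o marking_weight r' o * \sum_s mark (r e) s * F (upd o e s).
Proof.
move=> rr'.
transitivity (\sum_(o : {ffun I -> option K})
  \sum_s mark (r' e) s * (marking_weight r o * F o)).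
  by apply: eq_bigr => o _; rewrite -mulr_suml sum_mark mul1r.
under [RHS]eq_bigr do rewrite mulr_sumr.
rewrite !pair_big /=.
(* Exchanging the fresh value with [o e] is an involution that matches the two double sums term by
   term. *)
pose swap (x : {ffun I -> option K} * option K) := (upd x.1 e x.2, x.1 e).
have swapK : involutive swap.
  move=> [ o s]; rewrite /swap /= ffunE eqxx; congr (_, _).
  by apply/ffunP => i; rewrite !ffunE; case: eqP => [->|].
rewrite (reindex_inj (inv_inj swapK)) /=; apply: eq_bigr => -[ o s] _ /=.
rewrite mulrCA !mulrA; congr (_ * _).
rewrite /marking_weight (bigD1 e) //= [in RHS](bigD1 e) //= ffunE eqxx.
rewrite (eq_bigr (fun i => mark (r' i) (o i))) => [|i ie]; first by ring.
by rewrite ffunE (negPf ie) rr'.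
Qed.

(* The elements outside [B] act as jokers, so this interpolates between plain
   containment ([B] empty) and rainbow containment ([B] full). *)
Definition partly_rainbow (fam : {set {set I}}) B o :=
  [exists F in fam, [forall i in F, o i != None] &&
    [forall i in F :&: B, forall j in F :&: B, (o i == o j) ==> (i == j)]].

Lemma partly_rainbowP (fam : {set {set I}}) B o :
  reflect (exists F : {set I}, [/\ F \in fam, forall i, i \in F -> o i != None &
    forall i j, i \in F -> j \in F -> i \in B -> j \in B -> o i = o j -> i = j])
  (partly_rainbow fam B o).
Proof.
apply: (iffP existsP) => -[F].
  move=> /andP[Ff /andP[/forallP h1 /forallP h2]].
  exists F; split=> // [i|i j iF jF iB jB oij].
    by move: (h1 i) => /implyP.
  have /implyP := h2 i; rewrite finset.in_setI iF iB => /(_ isT)/forallP/(_ j).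
  by rewrite finset.in_setI jF jB oij eqxx => /eqP.
move=> [Ff h1 h2]; exists F; rewrite Ff /=; apply/andP; split.
  by apply/forallP => i; apply/implyP => /h1.
apply/forallP => i; apply/implyP; rewrite finset.in_setI => /andP[iF iB].
apply/forallP => j; apply/implyP; rewrite finset.in_setI => /andP[jF jB].
by apply/implyP => /eqP oij; apply/eqP; exact: h2.
Qed.

(* Once a member of [fam] is completed by an element [e] of some colour, every
   colour not carried by the rest of that member is admissible for [e]. *)
Lemma partly_rainbow_step (fam : {set {set I}}) B e o (M : nat) (p q : R) :
  e \notin B -> (forall F, F \in fam -> (#|F| <= M)%N) -> (M <= #|K|)%N ->
  0 <= p <= 1 -> 0 <= q <= 1 -> q * #|K|%:R <= p * (#|K| - M)%:R ->
  \sum_s mark q s * (partly_rainbow fam B (upd o e s))%:R <=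
  \sum_s mark p s * (partly_rainbow fam (e |: B) (upd o e s))%:R.
Proof.
move=> eB famM MK p01 q01 qp.
have [/andP[p0 _] /andP[q0 _]] := (p01, q01).
(* Three cases. If a member succeeds without [e], the right side is 1; if no colour of [e] helps,
   the left side is 0; otherwise the left side is at most [q] and the right side at least
   [p * (#|K| - M) / #|K|]. *)
case: (boolP (partly_rainbow fam B (upd o e None))) => [|hN].
  move=> /partly_rainbowP[F [Ff h1 h2]].
  have eF i : i \in F -> (i == e) = false.
    by move/h1; rewrite ffunE; case: (i == e).
  have h s : partly_rainbow fam (e |: B) (upd o e s).
    apply/partly_rainbowP; exists F; split => // [i iF|i j iF jF].
      by have := h1 i iF; rewrite !ffunE eF.
    rewrite !finset.in_setU1 !eF //= => iB jB.
    by have := h2 i j iF jF iB jB; rewrite !ffunE !eF.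
  under [leRHS]eq_bigr do rewrite h mulr1.
  rewrite sum_mark -[leRHS](sum_mark q); apply: ler_sum => s _.
  by rewrite ler_piMr ?mark_ge0 // lern1 leq_b1.
case: (boolP [exists k, partly_rainbow fam B (upd o e (Some k))]); last first.
  rewrite negb_exists => /forallP h; rewrite big1 => [|[k|] _].
  - by apply: sumr_ge0 => s _; rewrite mulr_ge0 ?mark_ge0.
  - by rewrite (negPf (h k)) mulr0.
  - by rewrite (negPf hN) mulr0.
move=> /existsP[k /partly_rainbowP[F [Ff h1 h2]]].
pose bad := [set k' | [exists i in F :&: B, o i == Some k']]%SET.
have badM : (#|bad| <= M)%N.
  apply: leq_trans (famM F Ff); apply: leq_trans (_ : #|F :&: B| <= _)%N; last first.
    by rewrite subset_leq_card ?finset.subsetIl.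
  apply: leq_trans (_ : #|[set o i | i in F :&: B]%SET| <= _)%N; last exact: leq_imset_card.
  have Some_i : injective (@Some K) by move=> a b [].
  rewrite -(card_imset _ Some_i); apply: subset_leq_card.
  apply/fintype.subsetP => _ /imsetP[k' + ->]; rewrite inE => /existsP[i /andP[iF /eqP <-]].
  exact: imset_f.
have good k' : k' \notin bad -> partly_rainbow fam (e |: B) (upd o e (Some k')).
  rewrite inE negb_exists => /forallP hk.
  have hk' i : i \in F -> i \in B -> o i != Some k'.
    by move=> iF iB; have := hk i; rewrite finset.in_setI iF iB.
  apply/partly_rainbowP; exists F; split => // [i iF|i j iF jF].
    by have := h1 i iF; rewrite !ffunE; case: (i == e).
  rewrite !finset.in_setU1 !ffunE.
  case: eqVneq => [->|ie] /=; case: eqVneq => [->|je] //= iB jB.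
  - by move/esym/eqP; rewrite (negPf (hk' _ jF jB)).
  - by move/eqP; rewrite (negPf (hk' _ iF iB)).
  - by have := h2 i j iF jF iB jB; rewrite !ffunE (negPf ie) (negPf je).
apply: (@le_trans _ _ q).
  rewrite sum_option (negPf hN) mulr0 add0r /=.
  apply: (@le_trans _ _ (\sum_(k0 : K) q / #|K|%:R)).
    by apply: ler_sum => k' _; rewrite ler_piMr ?lern1 ?leq_b1 ?divr_ge0 // ltW.
  rewrite sumr_const -(mulr_natr (q / _)) divfK ?lexx // gt_eqF //.
apply: (@le_trans _ _ (\sum_(k' in ~: bad) p / #|K|%:R)).
  rewrite sumr_const -(mulr_natr (p / _)) mulrAC ler_pdivlMr //.
  apply: le_trans qp _; apply: ler_wpM2l => //.
  by rewrite ler_nat; have := cardsC bad; lia.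
rewrite sum_option -[leLHS]add0r; apply: lerD; first by rewrite mulr_ge0 ?mark_ge0.
rewrite big_mkcond; apply: ler_sum => k' _.
case: ifP => [|_]; first by rewrite finset.in_setC => /good ->; rewrite mulr1.
by rewrite mulr_ge0 ?mark_ge0.
Qed.

Lemma partly_rainbow_coupling (fam : {set {set I}}) (M : nat) p q :
  (forall F, F \in fam -> (#|F| <= M)%N) -> (M <= #|K|)%N ->
  (forall i, 0 <= p i <= 1) -> (forall i, 0 <= q i <= 1) ->
  (forall i, q i * #|K|%:R <= p i * (#|K| - M)%:R) ->
  marking_prob q (partly_rainbow fam finset.set0) <=
  marking_prob p (partly_rainbow fam finset.setT).
Proof.
move=> famM MK p01 q01 qp.
(* Hybrid argument: the elements of [l] have already switched to rate [p] and to having their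
   colours counted. *)
pose h (l : seq I) i := if i \in l then p i else q i.
suff H l : uniq l -> marking_prob q (partly_rainbow fam finset.set0) <=
    marking_prob (h l) (partly_rainbow fam [set i in l]%SET).
  apply: le_trans (H _ (enum_uniq I)) _; rewrite le_eqVlt; apply/orP; left; apply/eqP.
  rewrite /marking_prob; apply: eq_big => o.
    by congr partly_rainbow; apply/setP => i; rewrite !inE mem_enum.
  by move=> _; apply: eq_bigr => i _; rewrite /h mem_enum.
elim: l => [_|e l IH /= /andP[el /IH {}IH]].
  rewrite le_eqVlt; apply/orP; left; apply/eqP; apply: eq_bigl => o.
  by congr partly_rainbow; apply/setP => i; rewrite !inE.
apply: le_trans IH _; rewrite !marking_probE.
have h01 i : 0 <= h l i <= 1 by rewrite /h; case: ifP.
rewrite (@marking_resample (h l) (h l) e) //.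
rewrite [leRHS](@marking_resample (h (e :: l)) (h l) e); last first.
  by move=> i ie; rewrite /h in_cons (negPf ie).
apply: ler_sum => o _; apply: ler_wpM2l; first exact: marking_weight_ge0.
have -> : h l e = q e by rewrite /h (negPf el).
have -> : h (e :: l) e = p e by rewrite /h mem_head.
have -> : [set i in e :: l]%SET = e |: [set i in l]%SET by apply/setP => i; rewrite !inE.
by apply: (@partly_rainbow_step fam _ e o M) => //; rewrite inE.
Qed.

End MarkedSets.

(** * Coloured random graphs *)

Section ColouredGraphs.
Variables (R : realType) (V K : finType).
Hypothesis K0 : (0 < #|K|)%N.

(** Rate 0 off the pairs allows markings to be indexed by all subsets of [V]. *)
Definition pair_rate (p : R) (e : {set V}) : R := if e \in pairs V then p else 0.

Lemma pair_rate01 p e : 0 <= p <= 1 -> 0 <= pair_rate p e <= 1.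
Proof. by rewrite /pair_rate; case: ifP => // _ _; rewrite lexx ler01. Qed.

Definition colour_marking (G : sgraph V) (c : colouring G K) :
  {ffun {set V} -> option K} := [ffun e => omap c (insub e)].

Lemma colour_marking_val (G : sgraph V) (c : colouring G K) (e : edge G) :
  colour_marking c (val e) = Some (c e).
Proof. by rewrite ffunE valK. Qed.

Lemma colour_marking_eq0 (G : sgraph V) (c : colouring G K) (e : {set V}) :
  (colour_marking c e == None) = (e \notin edges G).
Proof.
rewrite ffunE; case: insubP => [u uG _|/negPf ->] //=.
by rewrite uG.
Qed.

Lemma weight_colour_marking (p : R) (G : sgraph V) (c : colouring G K) :
  marking_weight (pair_rate p) (colour_marking c) =
  Gnp_weight p G * uniform_colouring_weight R c.
Proof.
have -> : uniform_colouring_weight R c = \prod_(e in edges G) (#|K|%:R)^-1.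
  rewrite /uniform_colouring_weight !prodr_const card_sig.
  by congr (_ ^+ _); apply: eq_card.
rewrite /marking_weight /Gnp_weight [in X in _ = X * _]big_mkcond.
rewrite [in X in _ = _ * X]big_mkcond -big_split /=; apply: eq_bigr => e _.
have := colour_marking_eq0 c e; rewrite /pair_rate.
case: (colour_marking c e) => [k|] /=; case: (boolP (e \in edges G)) => // eG _.
  by rewrite (fintype.subsetP (valP G) _ eG).
by case: ifP; rewrite ?subr0 mulr1.
Qed.

(** Markings are grouped by support. A support that is not a set of pairs has weight 0; any other is
    the edge set of a graph [G], and its markings correspond to the colourings of [G]. *)
Lemma Gnp_coloured_probE (p : R) (A : forall G : sgraph V, colouring G K -> Prop)
    (Q : pred {ffun {set V} -> option K}) :
  (forall G (c : colouring G K), A G c <-> Q (colour_marking c)) ->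
  Gnp_coloured_prob p A = marking_prob (pair_rate p) Q.
Proof.
move=> AQ; have /card_gt0P[k0 _] := K0.
pose supp (o : {ffun {set V} -> option K}) := [set e | o e != None]%SET.
rewrite /marking_prob (partition_big supp predT) //=.
rewrite (bigID (fun E : {set {set V}} => E \subset pairs V)) /=.
rewrite [X in _ = _ + X]big1 ?addr0; last first.
  move=> E /fintype.subsetPn[e eE ep]; apply: big1 => o /andP[_ /eqP oE].
  rewrite /marking_weight (bigD1 e) //= /pair_rate (negPf ep).
  by move: eE; rewrite -oE inE; case: (o e) => //= k _; rewrite !mul0r.
rewrite (reindex_omap (val : sgraph V -> _) insub) => [|E EP]; last by rewrite insubT.
rewrite /Gnp_coloured_prob; apply: eq_big => [G|G _].
  by rewrite (valP G) valK eqxx.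
(* The default [k0] is never read when the support of [o] is the edge set of [G]. *)
rewrite mulr_sumr; pose back o : colouring G K := [ffun e => odflt k0 (o (val e))].
rewrite [RHS](reindex_onto (@colour_marking G) back).
  apply: eq_big => [c|c _]; last by rewrite weight_colour_marking.
  have -> : supp (colour_marking c) == val G.
    by apply/eqP/setP => e; rewrite inE colour_marking_eq0 negbK.
  have -> : back (colour_marking c) == c.
    by apply/eqP/ffunP => e; rewrite ffunE colour_marking_val.
  by rewrite !andbT; apply/asboolP/idP => /AQ.
move=> o /andP[_ /eqP oG]; apply/ffunP => e; rewrite ffunE.
case: insubP => [u uG ue|eG] /=; last first.
  by move: eG; rewrite /edges -oG inE negbK => /eqP.
have : e \in supp o by rewrite oG.
by rewrite inE ffunE ue; case: (o e).
Qed.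

Definition copies (W : finType) (T : sgraph W) : {set {set {set V}}} :=
  [set F | `[< exists f : W -> V, injective f /\
     F = [set f @: (e : {set W}) | e in edges T]%SET >]]%SET.

Lemma copies_card (W : finType) (T : sgraph W) F :
  F \in copies T -> (#|F| <= #|edges T|)%N.
Proof. by rewrite inE => /asboolP[f [_ ->]]; exact: leq_imset_card. Qed.

Lemma rainbow_copyE (W : finType) (T : sgraph W) (G : sgraph V) (c : colouring G K) :
  has_rainbow_copy T c <-> partly_rainbow (copies T) finset.setT (colour_marking c).
Proof.
split=> [[f [injf [FG rF]]]|/partly_rainbowP[F [FT h1 h2]]].
  apply/partly_rainbowP; exists [set f @: (e : {set W}) | e in edges T]%SET.
  split; first by rewrite inE; apply/asboolP; exists f.
    by move=> e eF; rewrite colour_marking_eq0 negbK (fintype.subsetP FG).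
  move=> e1 e2 e1F e2F _ _.
  have e1G := fintype.subsetP FG _ e1F; have e2G := fintype.subsetP FG _ e2F.
  pose u1 : edge G := exist _ e1 e1G; pose u2 : edge G := exist _ e2 e2G.
  have := rF u1 u2 e1F e2F.
  have -> : colour_marking c e1 = Some (c u1) by exact: (colour_marking_val c u1).
  have -> : colour_marking c e2 = Some (c u2) by exact: (colour_marking_val c u2).
  by move=> h [/h /(congr1 val)].
move: FT; rewrite inE => /asboolP[f [injf FE]]; exists f; split=> //=; rewrite -FE.
split.
  by apply/fintype.subsetP => e /h1; rewrite colour_marking_eq0 negbK.
move=> e1 e2 e1F e2F c12; apply: val_inj; apply: h2 => //; rewrite ?inE //.
by rewrite !colour_marking_val c12.
Qed.

Definition marked_adj (o : {ffun {set V} -> option K}) : rel V :=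
  fun x y => o [set x; y]%SET != None.

Definition cut (A B : {set V}) : {set {set V}} := [set [set a; b]%SET | a in A, b in B]%SET.

Lemma cut_pairs A B : A :&: B = finset.set0 -> cut A B \subset pairs V.
Proof.
move=> AB; apply/fintype.subsetP => _ /imset2P[a b aA bB ->]; rewrite inE cards2.
have -> // : a != b; apply/eqP => ab.
by have := finset.in_set0 a; rewrite -AB inE aA ab bB.
Qed.

Lemma card_cut A B : A :&: B = finset.set0 -> #|cut A B| = (#|A| * #|B|)%N.
Proof.
move=> AB; rewrite /cut -cardsX curry_imset2X card_in_imset //.
move=> [a b] [a' b'] /setXP[/= aA bB] /setXP[/= a'A b'B] e.
have no x : x \in A -> x \in B -> False.
  by move=> xA xB; have := finset.in_set0 x; rewrite -AB inE xA xB.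
have : a \in [set a'; b']%SET by rewrite -e !inE eqxx.
have : b \in [set a'; b']%SET by rewrite -e !inE eqxx orbT.
move=> /set2P[E|->] /set2P[E'|E'] //.
- by case: (no b); rewrite // E.
- by case: (no a); rewrite // E'.
- by rewrite E'.
- by case: (no a); rewrite // E'.
Qed.

(** Union bound over at most [4 ^ #|V|] pairs of disjoint [m]-sets; for each, all [m * m] pairs of
    the cut must be absent. *)
Lemma marking_prob_not_joined (q : R) (m : nat) : 0 <= q <= 1 ->
  marking_prob (pair_rate q) (fun o => ~~ `[< joined (marked_adj o) m >]) <=
  4 ^+ #|V| * (1 - q) ^+ (m * m).
Proof.
move=> q01.
pose P (AB : {set V} * {set V}) :=
  [&& #|AB.1| == m, #|AB.2| == m & AB.1 :&: AB.2 == finset.set0].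
pose E (AB : {set V} * {set V}) :=
  [pred o : {ffun {set V} -> option K} |
  [forall e in cut AB.1 AB.2, o e == None]].
apply: le_trans (@marking_prob_union R _ K _ _ P _ E _ _) _.
- by move=> e; exact: pair_rate01.
- move=> o /asboolPn nj; apply: contrapT => h; apply: nj => A B cA cB AB.
  apply: contrapT => no; apply: h; exists (A, B); first by rewrite /P /= cA cB AB !eqxx.
  apply/forallP => e; apply/implyP => /imset2P[a b aA bB ->].
  apply: contrapT => /negP oab; apply: no; apply/existsP; exists a; rewrite aA /=.
  by apply/existsP; exists b; rewrite bB.
apply: (@le_trans _ _ (\sum_(AB | P AB) (1 - q) ^+ (m * m))).
  rewrite le_eqVlt; apply/orP; left; apply/eqP.
  apply: eq_bigr => -[A B] /and3P[/= /eqP cA /eqP cB /eqP AB].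
  rewrite marking_prob_cylinder // -{1}cA -cB -card_cut // -prodr_const.
  by apply: eq_bigr => e /(fintype.subsetP (cut_pairs AB)); rewrite /pair_rate => ->.
rewrite sumr_const -(mulr_natl _ #|_|); apply: ler_wpM2r.
  by rewrite exprn_ge0 // subr_ge0; case/andP: q01.
rewrite -natrX ler_nat; apply: leq_trans (max_card _) _.
by rewrite card_prod -!cardsT -!powersetT !card_powerset !cardsT -expnMn.
Qed.

Lemma joined_rainbow (W : finType) (T : sgraph W) m d (o : {ffun {set V} -> option K}) :
  joined (marked_adj o) m -> (0 < m)%N -> is_tree T -> (max_degree T <= d)%N ->
  (#|W| + (3 * d.+1 + 4) * m <= #|V|)%N ->
  partly_rainbow (copies T) finset.set0 o.
Proof.
move=> jm m0 treeT dT hV.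
have gs : symmetric (marked_adj o) by move=> x y; rewrite /marked_adj finset.setUC.
have [f injf fadj] := joined_tree_embedding gs jm m0 treeT dT hV.
apply/partly_rainbowP; exists [set f @: (e : {set W}) | e in edges T]%SET; split.
- by rewrite inE; apply/asboolP; exists f.
- move=> _ /imsetP[e eT ->].
  have /eqP/cards2P[x [y [xy eE]]] := edge_card2 eT.
  by rewrite eE finset.imsetU1 finset.imset_set1; apply: fadj; rewrite /adj -eE.
- by move=> i j _ _; rewrite inE.
Qed.

Lemma rainbow_tree_prob (W : finType) (T : sgraph W) m d (p q : R) :
  is_tree T -> (max_degree T <= d)%N -> (0 < m)%N ->
  (#|W| + (3 * d.+1 + 4) * m <= #|V|)%N -> (#|W| <= #|K|)%N ->
  0 <= p <= 1 -> 0 <= q <= 1 -> q * #|K|%:R <= p * (#|K| - #|W|)%:R ->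
  1 - 4 ^+ #|V| * (1 - q) ^+ (m * m) <=
    Gnp_coloured_prob p
      (fun (G : sgraph V) (c : colouring G K) => has_rainbow_copy T c) <= 1.
Proof.
move=> treeT dT m0 hV WK p01 q01 qp.
rewrite (Gnp_coloured_probE _ (fun G c => rainbow_copyE T c)).
apply/andP; split; last first.
  rewrite -[leRHS](@marking_prob1 R _ K K0 (pair_rate p)); apply: marking_prob_le => // e.
  exact: pair_rate01.
apply: le_trans (@partly_rainbow_coupling R _ K K0 (copies T) #|W| _
  (pair_rate q) _ _ _ _ _); first last.
- by move=> e; rewrite /pair_rate; case: ifP => //; rewrite !mul0r.
- by move=> e; exact: pair_rate01.
- by move=> e; exact: pair_rate01.
- by [].
- by move=> F /copies_card h; apply: leq_trans h (tree_edges_le treeT).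
(* Every marking either is not joined or contains a copy, so the two probabilities sum to at least
   1. *)
rewrite lerBlDr -[leLHS](@marking_prob1 R _ K K0 (pair_rate q)).
apply: le_trans (lerD (lexx _) (marking_prob_not_joined m q01)).
rewrite !marking_probE -big_split /=; apply: ler_sum => o _.
rewrite -mulrDr; apply: ler_wpM2l.
  by apply: marking_weight_ge0 => // e; exact: pair_rate01.
rewrite -natrD ler_nat; case: asboolP => [jm|_] /=; last by rewrite addn1.
by rewrite (joined_rainbow jm m0 treeT dT hV).
Qed.

End ColouredGraphs.

(** * Numerical estimate and choice of constants *)

Lemma expr_not_joined_le (R : realType) (n m N : nat) (q : R) :
  (0 < n)%N -> (0 < N)%N -> (n <= m * N)%N -> q = 3 * N%:R ^+ 2 / n%:R -> q <= 1 ->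
  4 ^+ n * (1 - q) ^+ (m * m) <= 2^-1 ^+ n :> R.
Proof.
move=> n0 N0 nmN qE q1.
have nR : 0 < n%:R :> R by rewrite ltr0n.
have h1 : (1 - q) ^+ (m * m) <= expR (- q) ^+ (m * m).
  by apply: lerXn2r; rewrite ?nnegrE ?subr_ge0 ?expR_ge0 // expR_ge1Dx.
(* Since [m * N >= n], the exponent [q * m ^ 2] is at least [3n]; as [e >= 2], the decay is at least
   [8 ^ n], which beats [4 ^ n]. *)
have h2 : expR (- q) ^+ (m * m) <= expR (- 3) ^+ n :> R.
  rewrite -!expRM_natl ler_expR !mulrN lerN2 qE mulrA ler_pdivlMr //.
  have : n%:R ^+ 2 <= (m%:R * N%:R) ^+ 2 :> R.
    by rewrite -natrM; apply: lerXn2r; rewrite ?nnegrE ?ler0n // ler_nat.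
  by rewrite natrM; nra.
have h3 : expR (- 3) <= 8^-1 :> R.
  have e2 : 2 <= expR 1 :> R by apply: le_trans (expR_ge1Dx 1); lra.
  rewrite expRN lef_pV2 ?posrE ?expR_gt0 //.
  have -> : expR 3 = expR 1 ^+ 3 :> R by rewrite -expRM_natl mulr1.
  by rewrite !exprS expr0; nra.
have h4 : expR (- 3) ^+ n <= 8^-1 ^+ n :> R.
  by apply: lerXn2r => //; rewrite nnegrE ?expR_ge0.
apply: (@le_trans _ _ (4 ^+ n * 8^-1 ^+ n)).
  by apply: ler_wpM2l; [exact: exprn_ge0|exact: le_trans h1 (le_trans h2 h4)].
rewrite -exprMn (_ : 4 * 8^-1 = 2^-1) //; by field.
Qed.

Theorem theorem1p4 (R : realType) (eps : R) (d : nat)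
    (heps : 0 < eps < 1) (hd : (2 <= d)%N) :
  exists C : R, 0 < C /\
    forall (W : nat -> finType) (T : forall n : nat, sgraph (W n)),
      (\forall n \near \oo,
        [/\ is_tree (T n),
            #|W n|%:R <= (1 - eps) * n%:R
          & max_degree (T n) = d]) ->
      (Gnp_coloured_prob (V := 'I_n) (C / n%:R) (K := 'I_n)
         (fun (G : sgraph 'I_n) (c : colouring G 'I_n) =>
            has_rainbow_copy (T n) c)) @[n --> \oo] --> (1 : R).
Proof.
have /andP[e0 e1] := heps.
pose L := (3 * d.+1 + 4)%N.
(* With [m] about [n / N], this makes the room [L * m] required by the embedding at most
   [eps * n]. *)
pose N := Num.bound (2 * L%:R / eps).
have NL : 2 * L%:R < eps * N%:R.
  have : 2 * L%:R / eps < N%:R by apply: archi_boundP; rewrite divr_ge0 ?mulr_ge0 // ltW.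
  by rewrite ltr_pdivrMr // (mulrC N%:R).
have N0 : (0 < N)%N.
  rewrite lt0n; apply/eqP => N0; move: NL.
  by rewrite N0 mulr0 ltNge mulr_ge0 ?ler0n.
have NR : 0 < N%:R :> R by rewrite ltr0n.
(* Chosen so that the uncoloured rate [eps * C / n] equals [3 * N ^ 2 / n]. *)
pose C := 3 * N%:R ^+ 2 / eps.
have C0 : 0 < C by rewrite divr_gt0 // mulr_gt0 // exprn_gt0.
exists C; split => // W T hT.
apply: (@squeeze_cvgr _ _ _ _ (fun n => 1 - 2^-1 ^+ n) (fun=> 1)); last exact: cvg_cst.
  near=> n.
  have [treeT cW dT] : [/\ is_tree (T n), #|W n|%:R <= (1 - eps) * n%:R
          & max_degree (T n) = d] by near: n.
  have Nn : (N <= n)%N by near: n; exact: nbhs_infty_ge.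
  have Cn : C <= n%:R by near: n; exact: nbhs_infty_ger.
  have n0 : (0 < n)%N by exact: leq_trans Nn.
  have nR : 0 < n%:R :> R by rewrite ltr0n.
  have Wn : (#|W n| <= n)%N by rewrite -(ler_nat R); apply: le_trans cW _; nra.
  pose m := (n %/ N).+1; pose p := C / n%:R; pose q := eps * p.
  have nm : (n <= m * N)%N by rewrite ltnW // ltn_ceil.
  (* Rounding up costs at most one extra [N], absorbed by [N <= n]; hence the factor 2 in [N]. *)
  have mn : (m * N <= 2 * n)%N.
    by rewrite /m mulSn mul2n -addnn leq_add // leq_divM.
  have p01 : 0 <= p <= 1.
    by apply/andP; split; [rewrite divr_ge0 // ltW|rewrite ler_pdivrMr // mul1r].
  have q01 : 0 <= q <= 1.
    by case/andP: p01 => p0 p1; apply/andP; rewrite /q; split; nra.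
  have hV : (#|W n| + L * m <= n)%N.
    rewrite -(ler_nat R) natrD natrM.
    have mn' : m%:R * N%:R <= 2 * n%:R :> R by rewrite -!natrM ler_nat.
    suff : L%:R * m%:R <= eps * n%:R by lra.
    rewrite -(ler_pM2r NR) -mulrA.
    have L0 : 0 <= L%:R :> R by [].
    nra.
  have := @rainbow_tree_prob R 'I_n 'I_n _ (W n) (T n) m d p q treeT.
  rewrite card_ord; move=> /(_ n0); rewrite dT => /(_ (leqnn d) isT hV Wn p01 q01).
  (* At least [eps * n] of the [n] colours remain outside a copy, which is the loss factor in
     [q]. *)
  have qp : q * n%:R <= p * (n - #|W n|)%:R.
    rewrite natrB // /q mulrAC mulrC; apply: ler_wpM2l; first by case/andP: p01.
    by lra.
  move=> /(_ qp) /andP[lo ->]; rewrite andbT; apply: le_trans lo.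
  rewrite lerD2l lerN2; apply: expr_not_joined_le n0 N0 nm _ _; last by case/andP: q01.
  by rewrite /q /p /C; field; rewrite !gt_eqF.
rewrite -[X in _ --> X]subr0; apply: cvgB; first exact: cvg_cst.
by apply: cvg_expr; rewrite ger0_norm ?invr_ge0 // invf_lt1 // ltr1n.
Unshelve. all: end_near.
Qed.
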